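(* Let $L,H>0$, $0<h_0<H$, $\Omega=(0,L)\times(0,H)$, and let $c\in L^\infty(\Omega)$ be a positive, non-constant function depending only on $x_2$, bounded below by a positive constant, and constant for $h_0<x_2<H$: $$c(x)=\gamma_0(x_2)\ \text{ if } 0<x_2<h_0,\qquad c(x)=c_1\ \text{ if } h_0<x_2<H,\qquad 0<\underline{c}:=\operatorname{ess\,inf} c<c_1 .$$ Let $A=-c\Delta$ be the positive self-adjoint operator acting in $L^2(\Omega,c^{-1}dx)$ with domain $D(A)=H^1_0(\Omega)\cap H^2(\Omega)$, with eigenvalues $\lambda_{k,\ell}$ and eigenfunctions $v_{k,\ell}$ ($k,\ell\ge1$). Let $\omega=(0,L)\times(a,b)$ with $h_0\le a<b\le H$, and let $\varepsilon>0$ be small enough. Then there is a constant $K_{\varepsilon,c}$ such that for every eigenvalue $\lambda_{k,\ell}$ satisfying $$\underline{c}\,\frac{k^2\pi^2}{L^2}<\lambda_{k,\ell}<(c_1-\varepsilon)\frac{k^2\pi^2}{L^2}$$ one has $$\frac{\|v_{k,\ell}\|^2_{L^2(\omega)}}{\|v_{k,\ell}\|^2_{L^2(\Omega)}}\le K_{\varepsilon,c}\,\exp\!\Big(-2\sqrt{\tfrac{k^2\pi^2}{L^2}-\tfrac{\lambda_{k,\ell}}{c_1}}\;(a-h_0)\Big).$$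
   Context: Separation of variables: for each integer $k\ge1$, $\lambda_{k,1}<\lambda_{k,2}<\cdots$ are the real numbers $\lambda$ for which there is a nonzero $u\in H^2(0,H)$ with $u''+\big(\frac{\lambda}{c}-\frac{k^2\pi^2}{L^2}\big)u=0$ on $(0,H)$ and $u(0)=u(H)=0$ (each such $\lambda$ is simple for fixed $k$); $u_{k,\ell}$ denotes such a solution for $\lambda=\lambda_{k,\ell}$. The functions $v_{k,\ell}(x_1,x_2)=a_{k,\ell}\sin(\frac{k\pi}{L}x_1)\,u_{k,\ell}(x_2)$, with normalizing constants $a_{k,\ell}\neq0$, form an orthonormal basis of eigenfunctions of $A$, $Av_{k,\ell}=\lambda_{k,\ell}v_{k,\ell}$. *)

(* Defs.v *)
From HB Require Import structures.
From mathcomp Require Import all_boot all_order all_algebra.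
From mathcomp Require Import all_classical all_reals all_analysis.
From mathcomp Require Import ess_sup_inf.

Set Implicit Arguments.
Unset Strict Implicit.
Unset Printing Implicit Defensive.

Import Order.TTheory GRing.Theory Num.Def Num.Theory.
Import numFieldNormedType.Exports.

Local Open Scope classical_set_scope.
Local Open Scope ring_scope.

Definition leb1 (R : realType) : {measure set (measurableTypeR R) -> \bar R} :=
  @lebesgue_measure R.

Definition leb2 (R : realType) :
    {measure set (measurableTypeR R * measurableTypeR R) -> \bar R} :=
  (@lebesgue_measure R \x @lebesgue_measure R)%E.

Section L2.
Context d (T : measurableType d) (R : realType).
Variable mu : {measure set T -> \bar R}.

Definition L2fun (D : set T) (f : T -> R) : Prop :=
  measurable_fun D f /\ mu.-integrable D (fun x => ((f x) ^+ 2)%:E).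

Definition L2norm_sq (D : set T) (f : T -> R) : R :=
  (\int[mu]_(x in D) ((f x) ^+ 2))%R.

(* The inner product of L^2(D, c^{-1} dmu). *)
Definition dotw (c : T -> R) (D : set T) (f g : T -> R) : R :=
  (\int[mu]_(x in D) (f x * g x / c x))%R.

(* [g] is the weak derivative of [f] on [D] for the differential operator
   [dop], tested against the functions in [test]. *)
Definition weak_deriv (test : set (T -> R)) (dop : (T -> R) -> T -> R)
    (D : set T) (f g : T -> R) : Prop :=
  forall phi, test phi ->
    (\int[mu]_(x in D) (f x * dop phi x) = - \int[mu]_(x in D) (g x * phi x))%R.

End L2.

Definition supported_in (R : realType) (X : topologicalType) (D : set X)
    (phi : X -> R) : Prop :=
  exists K : set X, [/\ compact K, K `<=` D & forall x, ~ K x -> phi x = 0].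

Section Dim1.
Variable R : realType.

(* C^1_c(D).  Testing against C^1_c or against C^infinity_c gives the same weak
   derivatives, by mollification. *)
Definition C1c (D : set R) : set (R -> R) := [set phi |
  [/\ forall x : R, derivable (phi : R -> R) x 1, continuous (phi^`()%classic : R -> R)
    & supported_in D phi]].

Definition weak_d (D : set R) (f g : R -> R) : Prop :=
  weak_deriv (@leb1 R) (C1c D) (fun phi => phi^`()%classic) D f g.

(* [u] belongs to H^2(D), with u' = [u1] and u'' = [u2]. *)
Definition H2_with (D : set R) (u u1 u2 : R -> R) : Prop :=
  [/\ L2fun (@leb1 R) D u, L2fun (@leb1 R) D u1, L2fun (@leb1 R) D u2,
      weak_d D u u1 & weak_d D u1 u2].

Definition xi2 (L : R) (k : nat) : R := k%:R ^+ 2 * pi ^+ 2 / L ^+ 2.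

(* [u] is a nonzero H^2(0, H) solution, with Dirichlet conditions, of
   u'' + (lam / c - k^2 pi^2 / L^2) u = 0, where [g] is the profile of c in x_2.
   As usual, an element of H^2(0, H) is identified with its representative that
   is continuous on [0, H]; this gives a meaning to u(0) and u(H). *)
Definition vertical_mode (L H : R) (g : R -> R) (k : nat) (lam : R)
    (u : R -> R) : Prop :=
  [/\ {within `[0, H], continuous u},
      exists2 t, t \in `[0, H] & u t != 0,
      u 0 = 0,
      u H = 0
    & exists u1 u2, H2_with `]0, H[ u u1 u2 /\
        {ae @leb1 R, forall t, t \in `]0, H[ ->
           u2 t + (lam / g t - xi2 L k) * u t = 0}].

(* For every k >= 1, lambda k 1 < lambda k 2 < ... are the numbers admitting a
   vertical mode, and [u k l] is a mode for [lambda k l]. *)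
Definition vertical_spectrum (L H : R) (g : R -> R)
    (lambda : nat -> nat -> R) (u : nat -> nat -> R -> R) : Prop :=
  forall k, (1 <= k)%N ->
  [/\ forall l m, (1 <= l)%N -> (l < m)%N -> lambda k l < lambda k m,
      forall lam, (exists w, vertical_mode L H g k lam w) <->
        (exists2 l, (1 <= l)%N & lam = lambda k l)
    & forall l, (1 <= l)%N -> vertical_mode L H g k (lambda k l) (u k l)].

Definition sep_mode (L : R) (alpha : nat -> nat -> R)
    (u : nat -> nat -> R -> R) (k l : nat) (x : R * R) : R :=
  alpha k l * sin (k%:R * pi / L * x.1) * u k l x.2.

(* The value on the interface t = h0 is immaterial. *)
Definition profile (h0 : R) (gamma0 : R -> R) (c1 : R) (t : R) : R :=
  if t < h0 then gamma0 t else c1.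

End Dim1.

Section Dim2.
Variable R : realType.
Local Notation plane := (measurableTypeR R * measurableTypeR R)%type.

Definition rect (a1 b1 a2 b2 : R) : set plane := `]a1, b1[ `*` `]a2, b2[.

Lemma measurable_rect a1 b1 a2 b2 : measurable (rect a1 b1 a2 b2).
Proof. by apply: measurableX; exact: measurable_itv. Qed.

Definition d1 (f : R * R -> R) (x : R * R) : R :=
  (fun t => f (t, x.2))^`()%classic x.1.

Definition d2 (f : R * R -> R) (x : R * R) : R :=
  (fun t => f (x.1, t))^`()%classic x.2.

Definition C1c2 (D : set (R * R)) : set (R * R -> R) := [set phi |
  [/\ forall x, derivable (fun t : R => phi (t, x.2)) x.1 1,
      forall x, derivable (fun t : R => phi (x.1, t)) x.2 1,
      continuous (d1 phi), continuous (d2 phi) & supported_in D phi]].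

Definition weak_d1 (D : set (R * R)) (f g : R * R -> R) : Prop :=
  weak_deriv (@leb2 R) (C1c2 D) d1 D f g.

Definition weak_d2 (D : set (R * R)) (f g : R * R -> R) : Prop :=
  weak_deriv (@leb2 R) (C1c2 D) d2 D f g.

(* [f] belongs to H^1(D), with gradient ([f1], [f2]). *)
Definition H1_with (D : set (R * R)) (f f1 f2 : R * R -> R) : Prop :=
  [/\ L2fun (@leb2 R) D f, L2fun (@leb2 R) D f1, L2fun (@leb2 R) D f2,
      weak_d1 D f f1 & weak_d2 D f f2].

(* H^1_0(D) is the closure of C^1_c(D) in H^1(D). *)
Definition H10_with (D : set (R * R)) (f f1 f2 : R * R -> R) : Prop :=
  H1_with D f f1 f2 /\
  forall e : R, 0 < e -> exists2 phi, C1c2 D phi &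
    L2norm_sq (@leb2 R) D (phi \- f) + L2norm_sq (@leb2 R) D (d1 phi \- f1)
      + L2norm_sq (@leb2 R) D (d2 phi \- f2) < e.

(* The graph of A = - c Laplacian with domain H^1_0(D) `&` H^2(D). *)
Definition opA (c : R * R -> R) (D : set (R * R)) (f g : R * R -> R) : Prop :=
  exists f1 f2 f11 f12 f21 f22,
  [/\ H10_with D f f1 f2, H1_with D f1 f11 f12, H1_with D f2 f21 f22
    & {ae @leb2 R, forall x, D x -> g x = - c x * (f11 x + f22 x)}].

(* ([lambda k l], [v k l]), k, l >= 1, is an orthonormal basis of eigenvectors
   of A in L^2(D, c^{-1} dx).  As c and 1/c are essentially bounded, L^2(D) and
   L^2(D, c^{-1} dx) have the same elements. *)
Definition eigenbasis (c : R * R -> R) (D : set (R * R))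
    (lambda : nat -> nat -> R) (v : nat -> nat -> R * R -> R) : Prop :=
  [/\ forall k l, (1 <= k)%N -> (1 <= l)%N ->
        opA c D (v k l) (fun x => lambda k l * v k l x),
      forall k l k' l', (1 <= k)%N -> (1 <= l)%N -> (1 <= k')%N -> (1 <= l')%N ->
        dotw (@leb2 R) c D (v k l) (v k' l') = ((k == k') && (l == l'))%:R
    & forall f, L2fun (@leb2 R) D f ->
        (forall k l, (1 <= k)%N -> (1 <= l)%N ->
          dotw (@leb2 R) c D f (v k l) = 0) ->
        {ae @leb2 R, forall x, D x -> f x = 0}].

Definition speed (h0 : R) (gamma0 : R -> R) (c1 : R) (x : R * R) : R :=
  profile h0 gamma0 c1 x.2.

(* c = [speed h0 gamma0 c1] is in L^infinity of the rectangle and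
   0 < clow = ess inf c < c1.  The last conditions entail that c is (almost
   everywhere) positive, bounded below by a positive constant, and not
   constant. *)
Definition layered_medium (L H h0 : R) (gamma0 : R -> R) (c1 clow : R) : Prop :=
  let c := speed h0 gamma0 c1 in
  let mu := mrestr (@leb2 R) (measurable_rect 0 L 0 H) in
  [/\ measurable_fun (rect 0 L 0 H) c,
      ('N[mu]_+oo [EFin \o c] < +oo)%E,
      ess_inf mu (EFin \o c) = clow%:E,
      0 < clow & clow < c1].

End Dim2.

(* Main.v *)
Require Import Defs.
From mathcomp Require Import all_boot all_order all_algebra.
From mathcomp Require Import all_classical all_reals all_analysis.
From mathcomp Require Import measurable_realfun lra ring.

Import Order.TTheory GRing.Theory Num.Def Num.Theory.
Import numFieldNormedType.Exports.

Local Open Scope classical_set_scope.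
Local Open Scope ring_scope.

(** Since v_{k,l} is a product, the factor alpha^2 times the integral of the
    squared sine is common to both norms and cancels ([L2norm_sq_rect]), so only
    the vertical mode u matters.

    Put m = sqrt (k^2 pi^2 / L^2 - lambda / c1), which is positive because
    lambda < (c1 - eps) k^2 pi^2 / L^2.  On the homogeneous layer (h0, H) the
    mode solves u'' = m^2 u and vanishes at H, hence it is a multiple of
    sinh (m (H - t)).  For d >= 0 and y >= 0,

      sinh y <= exp (- m d) sinh (y + m d),

    so u(t)^2 <= exp (- 2 m d) u(t - d)^2 as long as t - d stays in the layer
    ([exp_mode_shift_le]).  With d = a - h0, integrating over (a, b) and
    translating by d, the right-hand side becomes the integral of u^2 over
    (h0, b - d), which is at most that over (0, H)
    ([exp_mode_integral_decay]).  This gives the estimate with the constant 1.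

    The analytic point is that the equation is known only weakly: u is
    continuous, but u' and u'' are merely square integrable functions.  Factor
    d^2 - m^2 = (d - s)(d + s) with s = m or s = - m.  Testing with exp (- s t)
    phi shows that (u' + s u) exp (- s t) has zero weak derivative, so it acts
    on test functions as a constant, by the lemma of du Bois-Reymond.
    Subtracting the two identities obtained for s = m and s = - m eliminates u'
    and shows that 2 m u minus a combination of exp (m t) and exp (- m t) is
    orthogonal to all test functions.  This difference is continuous, so it is
    zero ([weak_solution_exp]). *)

(** * Continuous functions with compact support in an interval *)

(** The support is bounded by an interval rather than by a compact set, so that
    the support of a primitive can be read off directly. *)
Definition C0c {R : realType} (p q : R) (w : R -> R) : Prop :=
  continuous w /\ exists p' q', [/\ p < p', p' < q', q' < q
    & forall x, ~~ (p' <= x <= q') -> w x = 0].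

Lemma C0c_lin {R : realType} {p q r s : R} {v w : R -> R} :
  C0c p q v -> C0c p q w -> C0c p q (fun x => r * v x + s * w x).
Proof.
move=> [cv [p1 [q1 [pp1 pq1 qq1 v0]]]] [cw [p2 [q2 [pp2 pq2 qq2 w0]]]]; split.
  move=> x; apply: cvgD; apply: cvgM;
    by [exact: cvg_cst|exact: cv|exact: cw].
exists (minr p1 p2), (maxr q1 q2); split.
- by rewrite lt_min pp1.
- by rewrite gt_min !lt_max pq1.
- by rewrite gt_max qq1.
- move=> x; rewrite ge_min le_max => /negP h.
  rewrite v0 ?w0 ?mulr0 ?addr0//; apply/negP => /andP[h1 h2]; apply: h;
  by rewrite h1 h2 ?orbT.
Qed.

Lemma C0c_mul {R : realType} {p q : R} {g w : R -> R} :
  continuous g -> C0c p q w -> C0c p q (fun x => g x * w x).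
Proof.
move=> cg [cw [p' [q' [pp pq qq w0]]]]; split.
  by move=> x; apply: cvgM; [exact: cg|exact: cw].
by exists p', q'; split => // x /w0 ->; rewrite mulr0.
Qed.

Lemma C0c_bounded {R : realType} {p q : R} {w : R -> R} :
  C0c p q w -> exists M, forall x, `|w x| <= M.
Proof.
move=> [cw [p' [q' [pp pq qq w0]]]].
have cn : {within `[p', q'], continuous (fun x => `|w x|)}.
  by apply: continuous_subspaceT => x; apply: cvg_norm; exact: cw.
have [c _ hc] := EVT_max (ltW pq) cn.
exists `|w c| => x; have [xpq|/w0 ->] := boolP (p' <= x <= q').
  by apply: hc; rewrite in_itv.
by rewrite normr0.
Qed.

Lemma integrable_C0c {R : realType} {D : set R} {p q : R} {w : R -> R} :
  measurable D -> C0c p q w -> (leb1 R).-integrable D (EFin \o w).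
Proof.
move=> mD [cw [p' [q' [pp pq qq w0]]]].
apply: (@integrableS _ _ _ _ setT) => //.
have wi : (leb1 R).-integrable `[p', q'] (EFin \o w).
  apply: continuous_compact_integrable; first exact: segment_compact.
  exact: continuous_subspaceT.
have mI : measurable (`[p', q'] : set (measurableTypeR R)) by exact: measurable_itv.
have := (integrable_mkcond _ mI).1 wi.
rewrite (_ : _ \_ _ = EFin \o w)//; apply/funext => x.
rewrite /patch; case: ifPn => // /negP xpq; rewrite /= w0//.
by apply/negP => h; apply: xpq; rewrite inE/= in_itv.
Qed.

Lemma integrable_mul_C0c {R : realType} {D : set R} {p q : R} {f w : R -> R} :
  measurable D -> (leb1 R).-integrable D (EFin \o f) -> C0c p q w ->
  (leb1 R).-integrable D (EFin \o (fun x => f x * w x)).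
Proof.
move=> mD fi ccw; have [M hM] := C0c_bounded ccw.
rewrite (_ : EFin \o _ = (EFin \o f) \* (EFin \o w))%E; last first.
  by apply/funext => x; rewrite /= EFinM.
apply: integrableMl => //.
  by apply: measurable_funS (continuous_measurable_fun ccw.1).
exists M; split; first exact: num_real.
by move=> N MN x _ /=; rewrite (le_trans (hM x))// ltW.
Qed.

Lemma Rintegral_C0c {R : realType} {D : set R} {p q : R} {w : R -> R} :
  `]p, q[ `<=` D -> C0c p q w ->
  (\int[leb1 R]_(x in D) w x = \int[leb1 R]_x w x)%R.
Proof.
move=> pqD [cw [p' [q' [pp pq qq w0]]]]; rewrite Rintegral_mkcond.
apply: eq_Rintegral => x _; rewrite /patch; case: ifPn => // /negP xD.
rewrite w0//; apply/negP => /andP[h1 h2]; apply: xD; rewrite inE; apply: pqD.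
by rewrite /= in_itv/= (lt_le_trans pp h1) (le_lt_trans h2 qq).
Qed.

(** The vanishing of the total integral is what makes the primitive vanish to the
    right of the support of w. *)
Lemma C0c_primitive {R : realType} {p q : R} {w : R -> R} :
  C0c p q w -> (\int[leb1 R]_x w x)%R = 0 ->
  exists2 phi, C0c p q phi & forall x : R, is_derive x 1 phi (w x).
Proof.
move=> ccw w00; have [cw [p' [q' [pp pq qq w0]]]] := ccw.
pose phi y := (\int[leb1 R]_(t in [set` `]-oo, y]]) (w t))%R.
have dphi (z : R) : derivable phi z 1 /\ phi^`()%classic z = w z.
  apply: (@continuous_FTC1 R w -oo%O z (z + 1)) => //; last exact: cw.
  - by rewrite ltrDl.
  - exact: (@integrable_C0c R _ p q).
  - exact: ltNyr.
have dphi' : forall z : R, is_derive z 1 phi (w z).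
  move=> z; case: (dphi z) => h1 h2; apply: DeriveDef; first exact: h1.
  by rewrite -derive1E h2.
exists phi => //; split.
  move=> x; apply: differentiable_continuous; apply/derivable1_diffP.
  by have [] := dphi x.
exists p', q'; split => // x; rewrite negb_and -!ltNge => /orP[xp|qx].
- rewrite /phi (_ : (\int[leb1 R]_(t in _) _)%R =
                    (\int[leb1 R]_(t in [set` `]-oo, x]]) 0)%R).
    by rewrite /Rintegral integral0.
  apply: eq_Rintegral => t; rewrite inE/= in_itv/= => tx.
  by rewrite w0// negb_and -ltNge (le_lt_trans tx xp).
- rewrite -[RHS]w00 /phi Rintegral_mkcond; apply: eq_Rintegral => t _.
  rewrite /patch; case: ifPn => // /negP tx; rewrite w0// negb_and -!ltNge.
  apply/orP; right; rewrite (lt_trans qx)// ltNge; apply/negP => h; apply: tx.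
  by rewrite inE/= in_itv.
Qed.

(** * The fundamental lemma of the calculus of variations *)

Definition hat {R : realType} (p q x : R) : R := maxr 0 ((x - p) * (q - x)).

Lemma hat_eq0 {R : realType} {p q x : R} : ~~ (p < x < q) -> p < q -> hat p q x = 0.
Proof.
rewrite negb_and -!leNgt => h pq; apply/max_idPl.
by case/orP: h => h; [rewrite mulr_le0_ge0|rewrite mulr_ge0_le0];
   rewrite ?subr_le0 ?subr_ge0 //; [exact: le_trans (ltW pq)|exact: le_trans (ltW pq) _].
Qed.

Lemma hat_C0c {R : realType} {p q p' q' : R} :
  p < p' -> p' < q' -> q' < q -> C0c p q (hat p' q').
Proof.
move=> pp pq qq; split.
  move=> x.
  apply: (@continuous_max _ _ (cst 0) (fun t : R => (t - p') * (q' - t)) x).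
    exact: cst_continuous.
  by apply: cvgM; apply: cvgB; (exact: cvg_cst || exact: cvg_id).
exists p', q'; split => // x h.
by apply: hat_eq0 => //; apply: contra h => /andP[/ltW -> /ltW ->].
Qed.

Lemma hat_gt0 {R : realType} {p q x : R} : p < x -> x < q -> 0 < hat p q x.
Proof. by move=> px xq; rewrite lt_max mulr_gt0 ?subr_gt0// orbT. Qed.

Lemma hat_ge0 {R : realType} {p q x : R} : 0 <= hat p q x.
Proof. by rewrite le_max lexx. Qed.

Lemma Rintegral_gt0_itv {R : realType} {D : set R} {p q : R} {f : R -> R} :
  measurable D -> p < q -> `]p, q[ `<=` D ->
  (leb1 R).-integrable D (EFin \o f) ->
  (forall x, D x -> 0 <= f x) -> (forall x, p < x < q -> 0 < f x) ->
  0 < (\int[leb1 R]_(x in D) f x)%R.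
Proof.
move=> mD pq pqD fi f0 fpos.
rewrite lt0r Rintegral_ge0// andbT; apply/eqP => I0.
have mf : measurable_fun D (EFin \o f) by exact: (measurable_int (leb1 R)).
have aI0 : (\int[leb1 R]_(x in D) `|(EFin \o f) x| = 0)%E.
  have -> : (\int[leb1 R]_(x in D) `|(EFin \o f) x| = \int[leb1 R]_(x in D) (f x)%:E)%E.
    by apply: eq_integral => x; rewrite inE => /f0 fx; rewrite /= ger0_norm.
  by rewrite -[LHS]fineK ?integrable_fin_num//; congr EFin.
have [N [mN N0 hN]] := (ae_eq_integral_abs (leb1 R) mD mf).1 aI0.
have : (leb1 R [set` `]p, q[] <= leb1 R N)%E.
  apply: le_measure; rewrite ?inE//; apply: subset_trans hN => x /= xpq h.
  have := h (pqD x xpq); have := fpos x; rewrite in_itv/= in xpq.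
  by move=> /(_ xpq) fx [] /eqP; rewrite gt_eqF.
rewrite N0 (_ : leb1 R _ = (q - p)%:E); first by rewrite lee_fin leNgt subr_gt0 pq.
by have /= -> := @lebesgue_measure_itv R `]p, q[; rewrite lte_fin pq.
Qed.

(** A test function w differs from a multiple of a fixed bump w0 by a function of
    zero integral, and such a function is the derivative of a test function, to
    which y is orthogonal.  So the functional given by y is determined by its
    value on w0.

    Integrability is asked of the products with test functions because y will
    carry an exponential factor, which may be unbounded on D. *)
Lemma du_bois_reymond {R : realType} {D : set R} {p q : R} {y : R -> R} :
  measurable D -> p < q -> `]p, q[ `<=` D ->
  (forall w, C0c p q w ->
     (leb1 R).-integrable D (EFin \o (fun x => y x * w x))) ->
  (forall phi w, C0c p q phi -> C0c p q w ->
     (forall x : R, is_derive x 1 phi (w x)) ->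
     (\int[leb1 R]_(x in D) (y x * w x))%R = 0) ->
  exists C, forall w, C0c p q w ->
    (\int[leb1 R]_(x in D) (y x * w x) = C * \int[leb1 R]_(x in D) w x)%R.
Proof.
move=> mD pq pqD yi hy.
pose p' := (2 * p + q) / 3; pose q' := (p + 2 * q) / 3.
have pp : p < p' by rewrite /p'; lra.
have pq' : p' < q' by rewrite /p' /q'; lra.
have qq : q' < q by rewrite /q'; lra.
pose w0 := hat p' q'; have cw0 : C0c p q w0 by exact: hat_C0c.
pose I0 := (\int[leb1 R]_(x in D) w0 x)%R.
have I0gt : 0 < I0.
  apply: (@Rintegral_gt0_itv _ _ p' q') => //.
  - move=> x; rewrite /= in_itv/= => /andP[h1 h2]; apply: pqD.
    by rewrite /= in_itv/= (lt_trans pp h1) (lt_trans h2 qq).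
  - exact: (@integrable_C0c _ _ p q).
  - by move=> x _; exact: hat_ge0.
  - by move=> x /andP[h1 h2]; exact: hat_gt0.
exists ((\int[leb1 R]_(x in D) (y x * w0 x))%R / I0) => w cw.
pose Iw := (\int[leb1 R]_(x in D) w x)%R.
(* The coefficient of w0 is chosen to make the integral of v vanish. *)
pose v x := 1 * w x + (- (Iw / I0)) * w0 x.
have cv : C0c p q v by exact: C0c_lin.
have v0 : (\int[leb1 R]_x v x)%R = 0.
  rewrite -(@Rintegral_C0c _ D p q)// /v RintegralD//; last 2 first.
  - by apply: (@integrable_C0c _ _ p q) => //; apply: C0c_mul => //; exact: cst_continuous.
  - by apply: (@integrable_C0c _ _ p q) => //; apply: C0c_mul => //; exact: cst_continuous.
  rewrite !RintegralZl//; [|exact: (@integrable_C0c _ _ p q)..].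
  by rewrite mul1r mulNr -/I0 -/Iw divfK ?subrr// gt_eqF.
have [phi cphi dphi] := C0c_primitive cv v0.
have := hy phi v cphi cv dphi.
have yw0 := yi _ cw0.
have yw := yi _ cw.
under eq_Rintegral => x _.
  rewrite (_ : y x * v x = (y x * w x) - (Iw / I0) * (y x * w0 x)); last by rewrite /v; ring.
  over.
rewrite RintegralB//; last first.
  under [X in _.-integrable _ X]eq_fun do rewrite /= EFinM.
  exact: integrableZl.
rewrite RintegralZl// => /eqP; rewrite subr_eq0 => /eqP ->.
by rewrite -/Iw; field; rewrite gt_eqF.
Qed.

(** If f x is nonzero, then f x * f t is positive for t near x, and testing with
    f x times a bump supported near x gives a positive integral. *)
Lemma eq0_of_orthogonal_C0c {R : realType} {D : set R} {p q : R} {f : R -> R} :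
  measurable D -> `]p, q[ `<=` D ->
  (forall w, C0c p q w ->
     (leb1 R).-integrable D (EFin \o (fun x => f x * w x))) ->
  (forall x, p < x < q -> {for x, continuous f}) ->
  (forall w, C0c p q w -> (\int[leb1 R]_(x in D) (f x * w x))%R = 0) ->
  forall x, p < x < q -> f x = 0.
Proof.
move=> mD pqD fi cf h x xpq; apply/eqP; apply: contrapT => /negP fx0.
have {xpq} /andP[px xq] := xpq.
have [e e0 he] : exists2 e, 0 < e &
    [/\ p < x - e, x + e < q & forall t, x - e < t < x + e -> 0 < f x * f t].
  have cfx : {for x, continuous (fun t => f x * f t)}.
    by apply: cvgM; [exact: cvg_cst|apply: cf; rewrite px].
  have pos : 0 < f x * f x by rewrite -expr2 exprn_even_gt0.
  have : \forall t \near x, [/\ p < t, t < q & 0 < f x * f t].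
    near=> t; split; near: t.
    - exact: lt_nbhsr.
    - exact: lt_nbhsl.
    - exact: (cvgr_gt _ cfx).
  move=> /nbhs_ballP[e /= e0 he]; exists (e / 2); first by rewrite divr_gt0.
  have e2 : 0 < e / 2 by rewrite divr_gt0.
  have e2e : e / 2 < e by lra.
  split.
  - suff /he[] : ball x e (x - e / 2) by [].
    by rewrite /ball/= opprB addrCA subrr addr0 gtr0_norm.
  - suff /he[] : ball x e (x + e / 2) by [].
    by rewrite /ball/= opprD addNKr normrN gtr0_norm.
  - move=> t /andP[t1 t2]; suff /he[] : ball x e t by [].
    by rewrite /ball/= ltr_norml; apply/andP; split; lra.
case: he => pe eq he.
have cw : C0c p q (hat (x - e) (x + e)) by apply: hat_C0c => //; lra.
have cw' : C0c p q (fun t => f x * hat (x - e) (x + e) t).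
  by apply: C0c_mul => //; exact: cst_continuous.
have := h _ cw'; apply/eqP; rewrite gt_eqF//.
apply: (@Rintegral_gt0_itv _ _ (x - e) (x + e)) => //.
- lra.
- move=> t; rewrite /= in_itv/= => /andP[h1 h2]; apply: pqD; rewrite /= in_itv/=.
  by rewrite (lt_trans pe h1) (lt_trans h2 eq).
- exact: fi.
- move=> t _; have [ht|ht] := boolP (x - e < t < x + e); last first.
    by rewrite hat_eq0//; [rewrite !mulr0|lra].
  by rewrite mulrCA mulrA mulr_ge0 ?hat_ge0// ltW// he.
- move=> t ht; rewrite mulrCA mulrA mulr_gt0 ?he//.
  by case/andP: ht => *; exact: hat_gt0.
Unshelve. all: by end_near. Qed.

(** * Weak solutions of u'' = m^2 u *)

Lemma is_derive1_mul {R : realType} {f g : R -> R} {x a b : R} :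
  is_derive x 1 f a -> is_derive x 1 g b ->
  is_derive x 1 (fun t => f t * g t) (a * g x + f x * b).
Proof.
move=> fa gb; have := is_deriveM fa gb.
by rewrite /GRing.scale/= addrC (mulrC (g x)).
Qed.

Lemma is_derive_expRM {R : realType} (s x : R) :
  is_derive x 1 (fun t : R => expR (s * t)) (s * expR (s * x)).
Proof.
have h : is_derive x 1 (fun t : R => s * t) s.
  rewrite -[X in is_derive _ _ _ X](_ : 0 * x + s * 1 = s); last by rewrite mul0r mulr1 add0r.
  exact: is_derive1_mul (is_derive_cst _ _ _) (is_derive_id _ _).
by rewrite mulrC; exact: (is_derive1_comp (is_derive_expR _) h).
Qed.

Lemma continuous_expRM {R : realType} (s : R) : continuous (fun t : R => expR (s * t)).
Proof.
move=> x; apply: differentiable_continuous; apply/derivable1_diffP.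
by have [] := is_derive_expRM s x.
Qed.

Lemma integrable_EFinZl {R : realType} {D : set R} {r : R} {g : R -> R} :
  measurable D -> (leb1 R).-integrable D (EFin \o g) ->
  (leb1 R).-integrable D (EFin \o (fun x => r * g x)).
Proof.
move=> mD gi; rewrite (_ : EFin \o _ = (fun x => r%:E * (EFin \o g) x)%E)//.
exact: integrableZl.
Qed.

Lemma integrable_EFinD {R : realType} {D : set R} {g h : R -> R} :
  measurable D -> (leb1 R).-integrable D (EFin \o g) ->
  (leb1 R).-integrable D (EFin \o h) ->
  (leb1 R).-integrable D (EFin \o (fun x => g x + h x)).
Proof.
move=> mD gi hi; rewrite (_ : EFin \o _ = (EFin \o g) \+ (EFin \o h))%E//.
exact: integrableD.
Qed.

(** The weak derivative tested only against functions supported in (p, q), while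
    the integrals remain over D: a mode is a weak solution on the whole of
    (0, H), but its equation has constant coefficients only on (h0, H). *)
Definition weak_d_local {R : realType} (D : set R) (p q : R) (f g : R -> R) : Prop :=
  forall phi w, C0c p q phi -> C0c p q w ->
    (forall x : R, is_derive x 1 phi (w x)) ->
    (\int[leb1 R]_(x in D) (f x * w x) =
     - \int[leb1 R]_(x in D) (g x * phi x))%R.

(** If u'' = s^2 u, then y = u' + s u satisfies y' = s y, that is, y exp (- s t) is
    constant.  The conclusion states y = C exp (s t) against test functions, so
    that it makes sense when u' is known only as a weak derivative. *)
Lemma weak_first_integral {R : realType} {D : set R} {p q s : R} {u u1 : R -> R} :
  measurable D -> p < q -> `]p, q[ `<=` D ->
  (leb1 R).-integrable D (EFin \o u) -> (leb1 R).-integrable D (EFin \o u1) ->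
  weak_d_local D p q u u1 -> weak_d_local D p q u1 (fun x => s ^+ 2 * u x) ->
  exists C, forall w, C0c p q w ->
    (\int[leb1 R]_(x in D) (u1 x * w x) + s * \int[leb1 R]_(x in D) (u x * w x) =
     C * \int[leb1 R]_(x in D) (expR (s * x) * w x))%R.
Proof.
move=> mD pq pqD ui u1i wd1 wd2.
have ce r := continuous_expRM r.
have iu w : C0c p q w -> (leb1 R).-integrable D (EFin \o (fun x => u x * w x)).
  by move=> cw; apply: integrable_mul_C0c cw.
have iu1 w : C0c p q w -> (leb1 R).-integrable D (EFin \o (fun x => u1 x * w x)).
  by move=> cw; apply: integrable_mul_C0c cw.
have split w : C0c p q w ->
    (\int[leb1 R]_(x in D) ((u1 x + s * u x) * w x) =
     \int[leb1 R]_(x in D) (u1 x * w x) + s * \int[leb1 R]_(x in D) (u x * w x))%R.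
  move=> cw; under eq_Rintegral => x _ do rewrite mulrDl -mulrA.
  rewrite RintegralD//; last 2 first.
  - exact: iu1.
  - by apply: integrable_EFinZl => //; exact: iu.
  by rewrite RintegralZl//; exact: iu.
have [C hC] : exists C, forall w, C0c p q w ->
    (\int[leb1 R]_(x in D) ((u1 x + s * u x) * expR (- s * x) * w x) =
     C * \int[leb1 R]_(x in D) w x)%R.
  apply: (@du_bois_reymond _ _ p q) => //.
    move=> w cw; rewrite (_ : EFin \o _ = EFin \o (fun x =>
      u1 x * (expR (- s * x) * w x) + s * (u x * (expR (- s * x) * w x)))); last first.
      by apply/funext => x; congr EFin; ring.
    have cew : C0c p q (fun x => expR (- s * x) * w x) by exact: C0c_mul.
    by apply: integrable_EFinD => //; [exact: iu1|apply: integrable_EFinZl => //; exact: iu].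
  move=> phi w cphi cw dphi.
  (* By the product rule, psi' + s psi = exp (- s x) w. *)
  pose psi x := expR (- s * x) * phi x.
  pose psi' x := 1 * (expR (- s * x) * w x) + (- s) * psi x.
  have cpsi : C0c p q psi by exact: C0c_mul.
  have cpsi' : C0c p q psi' by apply: C0c_lin => //; exact: C0c_mul.
  have dpsi (x : R) : is_derive x 1 psi (psi' x).
    rewrite (_ : psi' x = - s * expR (- s * x) * phi x + expR (- s * x) * w x).
      exact: is_derive1_mul (is_derive_expRM _ _) (dphi x).
    by rewrite /psi' /psi; ring.
  have h1 := wd1 _ _ cpsi cpsi' dpsi.
  have := wd2 _ _ cpsi cpsi' dpsi.
  under [X in _ = - X]eq_Rintegral => x _ do rewrite -mulrA.
  rewrite RintegralZl//; last exact: iu.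
  move=> h2.
  have cv : C0c p q (fun x => 1 * psi' x + s * psi x) by exact: C0c_lin.
  under eq_Rintegral => x _.
    rewrite (_ : (u1 x + s * u x) * expR (- s * x) * w x =
                 (u1 x + s * u x) * (1 * psi' x + s * psi x)); last first.
      by rewrite /psi'; ring.
    over.
  rewrite split//.
  have lin f : (leb1 R).-integrable D (EFin \o f) ->
     (\int[leb1 R]_(x in D) (f x * (1 * psi' x + s * psi x)) =
      \int[leb1 R]_(x in D) (f x * psi' x) + s * \int[leb1 R]_(x in D) (f x * psi x))%R.
    move=> fi; under eq_Rintegral => x _ do rewrite mul1r mulrDr mulrCA.
    have f1 := integrable_mul_C0c mD fi cpsi.
    have f2 := integrable_mul_C0c mD fi cpsi'.
    rewrite RintegralD//; last exact: integrable_EFinZl.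
    by rewrite RintegralZl.
  rewrite !lin// h1 h2; ring.
exists C => w cw; rewrite -split//.
rewrite -hC; last exact: C0c_mul.
apply: eq_Rintegral => x _; rewrite -!mulrA (mulrA (expR _) (expR _)).
by rewrite -expRD mulNr addNr expR0 mul1r.
Qed.

(** The first integrals for s = m and s = - m give u' + m u = C exp (m t) and
    u' - m u = E exp (- m t); their difference does not involve u', so the
    continuity of u turns it into a pointwise identity. *)
Lemma weak_solution_exp {R : realType} {D : set R} {p q m : R} {u u1 : R -> R} :
  measurable D -> p < q -> `]p, q[ `<=` D -> m != 0 ->
  (leb1 R).-integrable D (EFin \o u) -> (leb1 R).-integrable D (EFin \o u1) ->
  (forall x, p < x < q -> {for x, continuous u}) ->
  weak_d_local D p q u u1 -> weak_d_local D p q u1 (fun x => m ^+ 2 * u x) ->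
  exists C E, forall x, p < x < q -> u x = C * expR (m * x) + E * expR (- m * x).
Proof.
move=> mD pq pqD m0 ui u1i cu wd1 wd2.
have [C hC] := weak_first_integral mD pq pqD ui u1i wd1 wd2.
have [E hE] : exists E, forall w, C0c p q w ->
    (\int[leb1 R]_(x in D) (u1 x * w x) + - m * \int[leb1 R]_(x in D) (u x * w x) =
     E * \int[leb1 R]_(x in D) (expR (- m * x) * w x))%R.
  by apply: weak_first_integral => //; rewrite sqrrN.
exists (C / (2 * m)), (- E / (2 * m)).
have m2 : 2 * m != 0 by rewrite mulf_neq0// pnatr_eq0.
pose f x := 2 * m * u x + ((- C) * expR (m * x) + E * expR (- m * x)).
suff f0 : forall x, p < x < q -> f x = 0.
  by move=> x /f0 fx; apply: (mulfI m2); rewrite -[LHS]subr0 -fx /f; field; rewrite m0.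
have ce r := continuous_expRM r.
have fw w (x : R) : f x * w x = 2 * m * (u x * w x) +
    (- C * (expR (m * x) * w x) + E * (expR (- m * x) * w x)).
  by rewrite /f; ring.
have iw w : C0c p q w -> [/\ (leb1 R).-integrable D (EFin \o (fun x => u x * w x)),
    (leb1 R).-integrable D (EFin \o (fun x => expR (m * x) * w x)) &
    (leb1 R).-integrable D (EFin \o (fun x => expR (- m * x) * w x))].
  by move=> cw; split; [apply: integrable_mul_C0c cw|
    apply: (@integrable_C0c _ _ p q) => //; exact: C0c_mul..].
apply: (@eq0_of_orthogonal_C0c _ D p q) => //.
- move=> w /iw[w1 w2 w3]; under eq_fun do rewrite fw.
  by apply: integrable_EFinD => //; [|apply: integrable_EFinD => //]; apply: integrable_EFinZl.
- move=> x xpq; apply: cvgD.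
    by apply: cvgM; [exact: cvg_cst|exact: cu].
  by apply: cvgD; (apply: cvgM; [exact: cvg_cst|exact: ce]).
- move=> w cw; have [w1 w2 w3] := iw w cw.
  under eq_Rintegral => x _ do rewrite fw.
  rewrite RintegralD//; last 2 first.
  - exact: integrable_EFinZl.
  - by apply: integrable_EFinD => //; apply: integrable_EFinZl.
  rewrite RintegralD//; [|exact: integrable_EFinZl..].
  rewrite !RintegralZl// mulNr -hC// -hE//; ring.
Qed.

(** * The vertical mode in the homogeneous layer *)

Lemma L2fun_integrable {R : realType} {a b : R} {f : R -> R} :
  L2fun (leb1 R) `]a, b[ f -> (leb1 R).-integrable `]a, b[ (EFin \o f).
Proof.
move=> [mf f2].
have mD : measurable (`]a, b[ : set (measurableTypeR R)) by exact: measurable_itv.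
have c1 : (leb1 R).-integrable `]a, b[ (EFin \o (fun=> 1%R)).
  have : (leb1 R).-integrable `[a, b] (EFin \o (fun=> 1%R)).
    apply: continuous_compact_integrable; first exact: segment_compact.
    by apply: continuous_subspaceT => x; exact: cvg_cst.
  apply: integrableS => //.
  exact: subset_itv_oo_cc.
apply: (@le_integrable _ _ _ _ _ mD _ (EFin \o (fun x => 1 + f x ^+ 2))).
- exact/measurable_EFinP.
- move=> x _; rewrite /= lee_fin [leRHS]ger0_norm ?addr_ge0 ?sqr_ge0//.
  rewrite -real_normK ?num_real//; have := normr_ge0 (f x).
  by set y := `|f x| => y0; nra.
- exact: integrable_EFinD.
Qed.

Lemma C0c_primitive_C1c {R : realType} {p q : R} {D : set R} {phi w : R -> R} :
  `]p, q[ `<=` D -> C0c p q phi -> continuous w ->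
  (forall x : R, is_derive x 1 phi (w x)) ->
  C1c D phi /\ phi^`()%classic = w.
Proof.
move=> pqD [_ [p' [q' [pp pq qq phi0]]]] cw dphi.
have dw : phi^`()%classic = w.
  by apply/funext => x; rewrite derive1E; have [_ ->] := dphi x.
split=> //; split.
- by move=> x; have [] := dphi x.
- by rewrite dw.
- exists [set` `[p', q']]; split; first exact: segment_compact.
    move=> x; rewrite /= in_itv/= => /andP[h1 h2]; apply: pqD.
    by rewrite /= in_itv/= (lt_le_trans pp h1) (le_lt_trans h2 qq).
  by move=> x; rewrite /= in_itv/= => /negP; exact: phi0.
Qed.

Lemma vertical_mode_exp {R : realType} {L H h0 : R} {gamma0 : R -> R} {c1 : R}
    {k : nat} {lam m : R} {u : R -> R} :
  0 < h0 -> h0 < H -> m != 0 -> m ^+ 2 = xi2 L k - lam / c1 ->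
  vertical_mode L H (profile h0 gamma0 c1) k lam u ->
  exists C E, forall x, h0 < x < H -> u x = C * expR (m * x) + E * expR (- m * x).
Proof.
move=> h00 h0H m0 m2 [cu _ _ _ [u1 [u2 [[L2u L2u1 L2u2 wu wu1] ode]]]].
pose D : set R := [set` `]0, H[].
have mD : measurable (D : set (measurableTypeR R)) by exact: measurable_itv.
have sD : `]h0, H[ `<=` D.
  by move=> x; rewrite /D /= !in_itv/= => /andP[h1 ->]; rewrite (lt_trans h00 h1).
have ui := L2fun_integrable L2u.
have u1i := L2fun_integrable L2u1.
have u2i := L2fun_integrable L2u2.
apply: (@weak_solution_exp _ D h0 H m u u1) => //.
- have [cu' _ _] := (continuous_within_itvP u (lt_trans h00 h0H)).1 cu.
  by move=> x /andP[h1 h2]; apply: cu'; rewrite in_itv/= (lt_trans h00 h1).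
- move=> phi w cphi cw dphi.
  by have [C1 <-] := C0c_primitive_C1c sD cphi cw.1 dphi; exact: wu.
- move=> phi w cphi cw dphi.
  have [C1 <-] := C0c_primitive_C1c sD cphi cw.1 dphi; rewrite wu1//; congr (- _).
  congr fine; apply: ae_eq_integral => //.
  + exact: measurable_int (integrable_mul_C0c mD u2i cphi).
  + exact: measurable_int (integrable_mul_C0c mD (integrable_EFinZl mD ui) cphi).
  apply: filterS ode; first exact: (ae_filter_ringOfSetsType (leb1 R)).
  move=> x /= h Dx; congr EFin.
  (* Below the interface phi vanishes; from h0 on the profile equals c1. *)
  have [xh0|h0x] := ltP x h0.
    have [_ [p' [q' [pp _ _ phi0]]]] := cphi.
    by rewrite phi0 ?mulr0// negb_and -ltNge (lt_trans xh0 pp).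
  congr (_ * _); have := h Dx; rewrite /profile ltNge h0x/= => /eqP.
  by rewrite addr_eq0 => /eqP ->; rewrite m2; ring.
Qed.

(** The condition at H makes the mode a multiple of sinh (m (H - x)), and
    sinh y <= exp (- m d) sinh (y + m d) for y >= 0 and d >= 0. *)
Lemma exp_mode_shift_le {R : realType} {H m C E : R} {x d : R} :
  0 < m -> 0 <= d -> x <= H -> C * expR (m * H) + E * expR (- m * H) = 0 ->
  (C * expR (m * x) + E * expR (- m * x)) ^+ 2 <=
  expR (- 2 * m * d) *
    (C * expR (m * (x - d)) + E * expR (- m * (x - d))) ^+ 2.
Proof.
move=> m0 d0 xH hH.
have hp : 0 < expR (m * H) by exact: expR_gt0.
have ap : 0 < expR (m * x) by exact: expR_gt0.
have bp : 0 < expR (m * d) by exact: expR_gt0.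
have ah : expR (m * x) <= expR (m * H) by rewrite ler_expR ler_wpM2l// ltW.
have b1 : 1 <= expR (m * d) by rewrite -expR0 ler_expR mulr_ge0// ltW.
have eb : expR (- 2 * m * d) = (expR (m * d) ^+ 2)^-1.
  by rewrite -expRM_natl -expRN; congr expR; ring.
have e1 : expR (m * (x - d)) = expR (m * x) / expR (m * d) by rewrite mulrBr expRB.
rewrite eb !mulNr !expRN e1 in hH *.
move: (expR (m * H)) (expR (m * x)) (expR (m * d)) hp ap bp ah b1 hH {eb e1} => h a b.
move=> hp ap bp ah b1 hH.
have h0' : h != 0 by rewrite gt_eqF.
have a0 : a != 0 by rewrite gt_eqF.
have b0 : b != 0 by rewrite gt_eqF.
have EC : E = - C * h ^+ 2.
  by rewrite -[LHS]subr0 -(mulr0 h) -hH; field.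
(* With a = exp (m x), b = exp (m d) and h = exp (m H), the mode at x is - C P and
   its translate, multiplied by exp (- m d), is - C Q. *)
pose P := h ^+ 2 / a - a; pose Q := h ^+ 2 / a - a / b ^+ 2.
rewrite (_ : C * a + E * a^-1 = - (C * P)); last by rewrite EC /P; field.
rewrite (_ : (b ^+ 2)^-1 * _ = (C * Q) ^+ 2); last first.
  by rewrite EC /Q; field; rewrite a0 b0.
rewrite sqrrN !exprMn ler_wpM2l ?sqr_ge0// ler_sqr ?nnegrE.
- by rewrite /P /Q lerB// ler_pdivrMr ?exprn_gt0// ler_peMr ?exprn_ege1 ?(ltW ap).
- by rewrite /P subr_ge0 ler_pdivlMr// -expr2 ler_sqr ?nnegrE ?(ltW ap) ?(ltW hp).
- rewrite /Q subr_ge0 (@le_trans _ _ a)//.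
    by rewrite ler_pdivrMr ?exprn_gt0// ler_peMr ?exprn_ege1 ?(ltW ap).
  by rewrite ler_pdivlMr// -expr2 ler_sqr ?nnegrE ?(ltW ap) ?(ltW hp).
Qed.

(** * Integral decay and separation of variables *)

Lemma integral_itv_shift {R : realType} {f : R -> R} {a b d : R} :
  a <= b -> continuous f ->
  (\int[leb1 R]_(x in `[(a - d)%R, (b - d)%R]) (f x)%:E =
   \int[leb1 R]_(x in `[a, b]) (f (x - d)%R)%:E)%E.
Proof.
move=> ab cf.
pose F : R -> R := fun x => x - d.
have dF (x : R) : is_derive x 1 F 1.
  rewrite -[X in is_derive _ _ _ X](subr0 1).
  exact: is_deriveB (is_derive_id _ _) (is_derive_cst _ _ _).
have F' : F^`()%classic = cst 1.
  by apply/funext => x; rewrite derive1E; have [_ ->] := dF x.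
have cF : continuous F.
  by move=> x; apply: cvgB; [exact: cvg_id|exact: cvg_cst].
have := @integration_by_substitution_increasing R F f a b ab.
rewrite F' => ->.
- by apply: eq_integral => x _; rewrite /= mulr1.
- by move=> x y _ _ xy; rewrite /F ltrD2r.
- by move=> x _; exact: cst_continuous.
- by apply: is_cvg_cst.
- by apply: is_cvg_cst.
- split; first by move=> x _; have [] := dF x.
  + exact/cvg_at_right_filter/cF.
  + exact/cvg_at_left_filter/cF.
- exact: continuous_subspaceT.
Qed.

(** Translating (a, b) down to the bottom h0 of the layer keeps it inside the
    layer, where the pointwise comparison of u with its translate applies. *)
Lemma exp_mode_integral_decay {R : realType} {H h0 m C E a b : R} {u : R -> R} :
  0 < h0 -> 0 < m -> h0 <= a -> a < b -> b <= H ->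
  {within `[0, H], continuous u} -> u H = 0 ->
  (leb1 R).-integrable `]0, H[ (fun x => ((u x) ^+ 2)%:E) ->
  (forall x, h0 < x < H -> u x = C * expR (m * x) + E * expR (- m * x)) ->
  (\int[leb1 R]_(x in `]a, b[) (u x) ^+ 2 <=
   expR (- 2 * m * (a - h0)) * \int[leb1 R]_(x in `]0, H[) (u x) ^+ 2)%R.
Proof.
move=> h00 m0 ha ab bH cu uH ui uE.
have h0H : h0 < H by rewrite (le_lt_trans ha)// (lt_le_trans ab).
(* s extends the formula for u to the whole line; by continuity of u it vanishes
   at H. *)
pose s x := C * expR (m * x) + E * expR (- m * x).
have cs : continuous s.
  by move=> x; apply: cvgD; (apply: cvgM; [exact: cvg_cst|exact: continuous_expRM]).
have sH : s H = 0.
  have [_ _ uH'] := (continuous_within_itvP u (lt_trans h00 h0H)).1 cu.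
  have sH' : s x @[x --> H^'-] --> s H by exact/cvg_at_left_filter/cs.
  rewrite -uH; apply: cvg_unique sH' _; first exact: Rhausdorff.
  apply: cvg_trans uH'; apply: near_eq_cvg; near=> x.
  by apply: uE; apply/andP; split; near: x; [exact: nbhs_left_gt|exact: nbhs_left_lt].
pose G x := s x ^+ 2.
have cG : continuous G by move=> x; apply: cvgM; exact: cs.
have mG D : measurable D -> measurable_fun (D : set (measurableTypeR R)) (EFin \o G).
  by move=> mD; apply/measurable_EFinP; apply: measurable_funS (continuous_measurable_fun cG).
have cGd r : continuous (fun x => G (x - r)).
  move=> x; apply: (@continuous_comp _ _ _ (fun t => t - r) G); last exact: cG.
  by apply: cvgB; [exact: cvg_id|exact: cvg_cst].
have mGd r D : measurable D ->
    measurable_fun (D : set (measurableTypeR R)) (fun x => (G (x - r))%:E).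
  move=> mD; apply/measurable_EFinP.
  by apply: measurable_funS (continuous_measurable_fun (cGd r)).
pose d := a - h0; have d0 : 0 <= d by rewrite subr_ge0.
have sub1 : `]a, b[ `<=` [set` `]h0, H[].
  move=> x; rewrite /= !in_itv/= => /andP[h1 h2].
  by rewrite (le_lt_trans ha h1) (lt_le_trans h2 bH).
have ereal_le : (\int[leb1 R]_(x in `]a, b[) ((u x) ^+ 2)%:E <=
   (expR (- 2 * m * d)%R)%:E * \int[leb1 R]_(x in `]0%R, H[) ((u x) ^+ 2)%:E)%E.
  have -> : (\int[leb1 R]_(x in `]a, b[) ((u x) ^+ 2)%:E =
             \int[leb1 R]_(x in `]a, b[) (EFin \o G) x)%E.
    by apply: eq_integral => x; rewrite inE => /sub1; rewrite /= in_itv => xab; rewrite /G uE.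
  apply: (@le_trans _ _ (\int[leb1 R]_(x in `[a, b]) (EFin \o G) x)%E).
    apply: ge0_subset_integral => //; [exact: mG|by move=> x _; rewrite lee_fin sqr_ge0|].
    exact: subset_itv_oo_cc.
  apply: (@le_trans _ _ (\int[leb1 R]_(x in `[a, b])
       ((expR (- 2 * m * d)%R)%:E * (G (x - d)%R)%:E))%E).
    apply: ge0_le_integral => //.
    - by move=> x _; rewrite lee_fin sqr_ge0.
    - exact: mG.
    - by apply: measurable_funeM; exact: mGd.
    - move=> x; rewrite /= in_itv/= => /andP[_ xb]; rewrite lee_fin /G /s.
      by apply: (@exp_mode_shift_le _ H) => //; exact: le_trans bH.
  rewrite ge0_integralZl_EFin//; last 2 first.
  - by move=> x _; rewrite lee_fin sqr_ge0.
  - exact: mGd.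
  rewrite lee_pmul2l ?lte_fin ?expR_gt0//.
  rewrite -integral_itv_shift ?(ltW ab)// (_ : a - d = h0); last by rewrite /d; ring.
  rewrite -integral_itv_bndo_bndc; last exact: mG.
  rewrite -integral_itv_obnd_cbnd; last exact: mG.
  have sub2 : `]h0, b - d[ `<=` [set` `]h0, H[].
    move=> x; rewrite /= !in_itv/= => /andP[-> h2]/=.
    by rewrite (lt_le_trans h2)// lerBlDr (le_trans bH)// lerDl.
  have -> : (\int[leb1 R]_(x in `]h0, (b - d)%R[) (G x)%:E =
             \int[leb1 R]_(x in `]h0, (b - d)%R[) (u x ^+ 2)%:E)%E.
    by apply: eq_integral => x; rewrite inE => /sub2; rewrite /= in_itv => xab; rewrite /G uE.
  apply: ge0_subset_integral => //.
  - exact: measurable_int ui.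
  - by move=> x _; rewrite lee_fin sqr_ge0.
  - apply: subset_trans sub2 _ => x; rewrite /= !in_itv/= => /andP[h1 ->].
    by rewrite (lt_trans h00 h1).
have m0H : measurable (`]0, H[ : set (measurableTypeR R)) by exact: measurable_itv.
have fin0H := integrable_fin_num m0H ui.
rewrite /Rintegral -[X in X * _]/(fine (expR (- 2 * m * d))%:E) -fineM//.
apply: fine_le => //; last by rewrite fin_numM.
have sub3 : `]a, b[ `<=` [set` `]0, H[].
  apply: subset_trans sub1 _ => x; rewrite /= !in_itv/= => /andP[h1 ->].
  by rewrite (lt_trans h00 h1).
have mab : measurable (`]a, b[ : set (measurableTypeR R)) by exact: measurable_itv.
exact (integrable_fin_num mab (integrableS m0H mab sub3 ui)).
Unshelve. all: by end_near. Qed.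

(** Tonelli's theorem for the squares of f and g, extended by zero outside their
    intervals. *)
Lemma L2norm_sq_rect {R : realType} {a1 b1 a2 b2 : R} {f g : R -> R} :
  (leb1 R).-integrable `]a1, b1[ (EFin \o (fun x => f x ^+ 2)) ->
  (leb1 R).-integrable `]a2, b2[ (EFin \o (fun x => g x ^+ 2)) ->
  L2norm_sq (leb2 R) (rect a1 b1 a2 b2) (fun z => f z.1 * g z.2) =
  (\int[leb1 R]_(x in `]a1, b1[) f x ^+ 2 * \int[leb1 R]_(x in `]a2, b2[) g x ^+ 2)%R.
Proof.
move=> fi gi.
pose I : set (measurableTypeR R) := [set` `]a1, b1[].
pose J : set (measurableTypeR R) := [set` `]a2, b2[].
have mI : measurable I by exact: measurable_itv.
have mJ : measurable J by exact: measurable_itv.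
pose F := (EFin \o (fun x => f x ^+ 2)) \_ I.
pose G := (EFin \o (fun x => g x ^+ 2)) \_ J.
have mF : measurable_fun setT F.
  by apply/(measurable_restrictT _ mI); exact: measurable_int fi.
have mG : measurable_fun setT G.
  by apply/(measurable_restrictT _ mJ); exact: measurable_int gi.
have F0 x : (0 <= F x)%E.
  by rewrite /F patchE; case: ifP => // _; rewrite lee_fin sqr_ge0.
have G0 x : (0 <= G x)%E.
  by rewrite /G patchE; case: ifP => // _; rewrite lee_fin sqr_ge0.
have E1 : (\int[leb2 R]_(z in rect a1 b1 a2 b2) ((f z.1 * g z.2) ^+ 2)%:E =
           \int[leb2 R]_z (F z.1 * G z.2))%E.
  rewrite integral_mkcond; apply: eq_integral => -[x y] _.
  rewrite /F /G !patchE /= /rect (_ : (_ \in _ `*` _) = (x \in I) && (y \in J)).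
    by case: ifP => [/andP[-> ->]|/negbT]; [rewrite exprMn EFinM|
       rewrite negb_and => /orP[|] /negbTE ->; rewrite ?mul0e ?mule0].
  by apply/idP/andP; rewrite !inE.
rewrite /L2norm_sq /Rintegral E1 /leb2 fubini_tonelli1//; last 2 first.
- by apply: emeasurable_funM; [exact: measurableT_comp mF _|exact: measurableT_comp mG _].
- by move=> z; rewrite mule_ge0.
rewrite /fubini_F /=.
under eq_integral => x _ do rewrite ge0_integralZl//.
rewrite ge0_integralZr//; last exact: integral_ge0.
rewrite /F /G -!integral_mkcond fineM//.
- exact: (@integrable_fin_num _ _ _ (leb1 R)).
- exact: (@integrable_fin_num _ _ _ (leb1 R)).
Qed.

Theorem mainTheorem1 (R : realType) (L H h0 : R) (gamma0 : R -> R) (c1 clow : R)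
    (hL : 0 < L) (hh0 : 0 < h0) (hH : h0 < H)
    (hc : layered_medium L H h0 gamma0 c1 clow) :
  exists2 eps0 : R, 0 < eps0 & forall eps : R, 0 < eps -> eps < eps0 ->
  exists K : R,
  forall (lambda : nat -> nat -> R) (u : nat -> nat -> R -> R)
    (alpha : nat -> nat -> R),
  vertical_spectrum L H (profile h0 gamma0 c1) lambda u ->
  (forall k l, (1 <= k)%N -> (1 <= l)%N -> alpha k l != 0) ->
  eigenbasis (speed h0 gamma0 c1) (rect 0 L 0 H) lambda (sep_mode L alpha u) ->
  forall a b : R, h0 <= a -> a < b -> b <= H ->
  forall k l : nat, (1 <= k)%N -> (1 <= l)%N ->
  clow * xi2 L k < lambda k l -> lambda k l < (c1 - eps) * xi2 L k ->
  L2norm_sq (leb2 R) (rect 0 L a b) (sep_mode L alpha u k l)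
    / L2norm_sq (leb2 R) (rect 0 L 0 H) (sep_mode L alpha u k l)
  <= K * expR (- 2 * Num.sqrt (xi2 L k - lambda k l / c1) * (a - h0)).
Proof.
exists 1 => // eps eps0 _; exists 1 => lambda u alpha spec _ _ a b ha ab bH.
move=> k l k1 l1 _ hlam.
have [_ _ _ clow0 clowc1] := hc.
have c10 : 0 < c1 by exact: lt_trans clowc1.
have xi0 : 0 <= xi2 L k by rewrite /xi2 -exprMn -expr_div_n sqr_ge0.
have gap : 0 < xi2 L k - lambda k l / c1.
  rewrite subr_gt0 ltr_pdivrMr// (lt_le_trans hlam)// mulrC ler_wpM2l//.
  by rewrite lerBlDr lerDl ltW.
set m := Num.sqrt _.
have m0 : 0 < m by rewrite sqrtr_gt0.
have m2 : m ^+ 2 = xi2 L k - lambda k l / c1 by rewrite sqr_sqrtr// ltW.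
have [_ _ /(_ l l1) mode] := spec k k1.
have [C [E uE]] := vertical_mode_exp hh0 hH (lt0r_neq0 m0) m2 mode.
have [cu _ _ uH [u1 [u2 [[[_ u2i] _ _ _ _] _]]]] := mode.
have decay := exp_mode_integral_decay hh0 m0 ha ab bH cu uH u2i uE.
pose f x := alpha k l * sin (k%:R * pi / L * x).
have fi : (leb1 R).-integrable `]0, L[ (EFin \o (fun x => f x ^+ 2)).
  have : (leb1 R).-integrable `[0, L] (EFin \o (fun x => f x ^+ 2)).
    apply: continuous_compact_integrable; first exact: segment_compact.
    apply: continuous_subspaceT => x; have cf : {for x, continuous f}.
      apply: cvgM; first exact: cvg_cst.
      apply: continuous_comp; last exact: continuous_sin.
      by apply: cvgM; [exact: cvg_cst|exact: cvg_id].
    exact: cvgM.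
  apply: integrableS => //; exact: subset_itv_oo_cc.
have uabi : (leb1 R).-integrable `]a, b[ (EFin \o (fun x => u k l x ^+ 2)).
  apply: integrableS u2i => // x; rewrite /= !in_itv/= => /andP[h1 h2].
  by rewrite (lt_le_trans hh0 (le_trans ha (ltW h1))) (lt_le_trans h2).
rewrite (L2norm_sq_rect fi uabi) (L2norm_sq_rect fi u2i).
set S := Rintegral _ _ _; set U := Rintegral _ _ _ in decay *.
set V := Rintegral _ _ _ in decay *.
have S0 : 0 <= S by apply: Rintegral_ge0 => x _; exact: sqr_ge0.
have V0 : 0 <= V by apply: Rintegral_ge0 => x _; exact: sqr_ge0.
(* Division by zero yields zero, so a vanishing denominator is harmless. *)
rewrite mul1r; have [SV0|SV0] := eqVneq (S * V) 0.
  by rewrite SV0 invr0 mulr0 expR_ge0.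
rewrite ler_pdivrMr; last by rewrite lt0r SV0 mulr_ge0.
by rewrite mulrCA ler_wpM2l.
Qed.
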